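(* Let $\phi$ be a 1-coercive and Legendre dgf on $\mathbb R^n$, $X=\operatorname{dom}\phi$, and let $f:X\to\overline{\mathbb R}$ be proper, lsc, and $\phi$-prox-bounded with threshold $\lambda_f$. Then, for any $\lambda\in(0,\lambda_f)$ and $\bar x\in\operatorname{int}X$ the following are equivalent: (a) $\overleftarrow{\partial}_\lambda f(\bar x)$ is a singleton. (b) $\operatorname{conv}(f+\lambda^{-1}\phi)$ is differentiable at $\bar x$ and coincides with $f+\lambda^{-1}\phi$ at $\bar x$. (c) $\mathrm{hull}_\lambda f$ is differentiable at $\bar x$ and coincides with $f$ at $\bar x$. Under any of these equivalent conditions, one also has $\nabla[\operatorname{conv}(f+\lambda^{-1}\phi)](\bar x)=\bar u+\lambda^{-1}\nabla\phi(\bar x)$ and $\nabla(\mathrm{hull}_\lambda f)(\bar x)=\bar u$, where $\{\bar u\}=\overleftarrow{\partial}_\lambda f(\bar x)$.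
   Context: $\overline{\mathbb R}=[-\infty,\infty]$. A distance-generating function (dgf) is a proper, lsc, convex $\phi:\mathbb R^n\to\overline{\mathbb R}$ differentiable on $Y=\operatorname{int}\operatorname{dom}\phi\neq\emptyset$. $D_\phi(x,y)=\phi(x)-\phi(y)-\langle\nabla\phi(y),x-y\rangle$ if $y\in Y$, and $\infty$ otherwise. $\phi$ is Legendre if it is essentially smooth (differentiable on $Y\ne\emptyset$ with $\|\nabla\phi(x^k)\|\to\infty$ whenever $Y\ni x^k\to x\in\operatorname{bdry}\operatorname{dom}\phi$) and essentially strictly convex (strictly convex on every convex subset of $\operatorname{dom}\partial\phi$). $\phi$ is 1-coercive if $\liminf_{\|x\|\to\infty}\phi(x)/\|x\|=\infty$. $f:X\to\overline{\mathbb R}$ is proper if not identically $\infty$ and never $-\infty$; lsc is meant relative to $X$. $f+\lambda^{-1}\phi$ is a function on $X$; $\operatorname{conv}h$ is the pointwise supremum of all convex functions $X\to\overline{\mathbb R}$ majorized by $h$. $\overleftarrow{\mathrm{env}}_\lambda f(\bar y)=\inf_{x\in X}\{f(x)+\frac1\lambda D_\phi(x,\bar y)\}$ for $\bar y\in Y$; for $g:Y\to\overline{\mathbb R}$, $\overrightarrow{\mathrm{env}}_\lambda g(\bar x)=\inf_{y\in Y}\{g(y)+\frac1\lambda D_\phi(\bar x,y)\}$ for $\bar x\in X$; $\mathrm{hull}_\lambda f=-\overrightarrow{\mathrm{env}}_\lambda(-\overleftarrow{\mathrm{env}}_\lambda f):X\to\overline{\mathbb R}$. $f$ is $\phi$-prox-bounded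 if $\overleftarrow{\mathrm{env}}_\lambda f(y)>-\infty$ for some $\lambda>0$, $y\in Y$; $\lambda_f$ is the supremum of all such $\lambda$. Left Bregman level proximal subdifferential: $\bar u\in\overleftarrow{\partial}_\lambda f(\bar x)$ iff $\bar x\in\operatorname{int}X$ and $f(x)\ge f(\bar x)+\langle\bar u,x-\bar x\rangle-\frac1\lambda D_\phi(x,\bar x)$ for all $x\in X$. *)

(* Defs.v *)
From HB Require Import structures.
From mathcomp Require Import all_boot all_order all_algebra.
From mathcomp Require Import all_classical all_reals all_analysis.

Set Implicit Arguments.
Unset Strict Implicit.
Unset Printing Implicit Defensive.

Import Order.TTheory GRing.Theory Num.Theory.
Import numFieldNormedType.Exports.

Local Open Scope classical_set_scope.
Local Open Scope ring_scope.

Section euclidean.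
Context {R : realType} {n : nat}.
Implicit Types x y v : 'rV[R]_n.

Definition dotp x y : R := \sum_(i < n) x ord0 i * y ord0 i.

(* The library norm of 'rV[R]_n is the sup norm, hence this one. *)
Definition enorm x : R := Num.sqrt (dotp x x).

Definition enorm_infty : set_system 'rV[R]_n :=
  [set A | exists M : R, forall x, M < enorm x -> A x].

End euclidean.

(* A function defined on D (with D a set of vectors) is represented by a total
   function whose values outside D are never taken into account. *)
Section extended_real_functions.
Context {R : realType} {n : nat}.
Implicit Types (D : set 'rV[R]_n) (f g h : 'rV[R]_n -> \bar R).
Local Open Scope ereal_scope.

Definition edom f : set 'rV[R]_n := [set x | f x < +oo].

Definition eproper D f :=
  (exists2 x, D x & f x != +oo) /\ (forall x, D x -> f x != -oo).

(* Points outside D are isolated in subspace D, so this only says something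
   about the points of D. *)
Definition elsc D f := lower_semicontinuous (f : subspace D -> \bar R).

Definition epigraph D f : set ('rV[R]_n * R^o) :=
  [set p | D p.1 /\ f p.1 <= (p.2 : R)%:E].

(* Convexity is convexity of the epigraph, since f may take both infinite
   values. *)
Definition econvex D f := convex_set (epigraph D f).

Definition estrictly_convex D f := forall x y (t : R),
  D x -> D y -> x != y -> (0 < t < 1)%R ->
  f (t *: x + (1 - t) *: y)%R < t%:E * f x + (1 - t)%:E * f y.

Definition edifferentiable f x :=
  (\forall y \near x, f y \is a fin_num) /\
  differentiable (fine \o f : 'rV[R]_n -> R^o) x.

Definition gradient f x : 'rV[R]_n :=
  \row_(i < n) 'd (fine \o f : 'rV[R]_n -> R^o) x (delta_mx ord0 i).

Definition subdifferential f x : set 'rV[R]_n :=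
  [set v | forall y, f x + (dotp v (y - x))%:E <= f y].

Definition econv D h x : \bar R :=
  ereal_sup [set g x | g in
    [set g | econvex D g /\ forall y, D y -> g y <= h y]].

End extended_real_functions.

Section distance_generating_functions.
Context {R : realType} {n : nat}.
Implicit Types (phi : 'rV[R]_n -> \bar R).
Local Open Scope ereal_scope.

Definition dgf phi :=
  [/\ eproper setT phi, lower_semicontinuous phi, econvex setT phi,
      (edom phi)° !=set0 &
      forall y, (edom phi)° y -> edifferentiable phi y].

Definition essentially_smooth phi :=
  [/\ (edom phi)° !=set0,
      forall y, (edom phi)° y -> edifferentiable phi y &
      forall (u : nat -> 'rV[R]_n) x,
        (forall k, (edom phi)° (u k)) -> u @ \oo --> x ->
        (closure (edom phi) `\` (edom phi)°) x ->
        enorm (gradient phi (u k)) @[k --> \oo] --> +oo%R].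

Definition essentially_strictly_convex phi :=
  forall C : set 'rV[R]_n, convex_set C ->
    C `<=` [set x | subdifferential phi x !=set0] -> estrictly_convex C phi.

Definition legendre phi :=
  essentially_smooth phi /\ essentially_strictly_convex phi.

Definition one_coercive phi :=
  limf_einf (fun x => phi x * (enorm x)^-1%:E) enorm_infty = +oo.

End distance_generating_functions.

Section bregman.
Context {R : realType} {n : nat}.
Variable phi : 'rV[R]_n -> \bar R.
Implicit Types (f g : 'rV[R]_n -> \bar R) (lambda : R).
Local Open Scope ereal_scope.

Let X : set 'rV[R]_n := edom phi.
Let Y : set 'rV[R]_n := (edom phi)°.

Definition bregman x y : \bar R :=
  if y \in Y then phi x - phi y - (dotp (gradient phi y) (x - y))%:E else +oo.

Definition left_env lambda f y : \bar R :=
  ereal_inf [set f x + lambda^-1%:E * bregman x y | x in X].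

Definition right_env lambda g x : \bar R :=
  ereal_inf [set g y + lambda^-1%:E * bregman x y | y in Y].

Definition hull lambda f x : \bar R :=
  - right_env lambda (fun y => - left_env lambda f y) x.

Definition prox_bound_params f : set R :=
  [set lambda | (0 < lambda)%R /\
    exists2 y, Y y & -oo < left_env lambda f y].

Definition prox_bounded f := prox_bound_params f !=set0.

Definition prox_threshold f : \bar R :=
  ereal_sup [set lambda%:E | lambda in prox_bound_params f].

Definition level_prox_subdiff lambda f x : set 'rV[R]_n :=
  [set u | Y x /\ forall z, X z ->
    f x + (dotp u (z - x))%:E - lambda^-1%:E * bregman z x <= f z].

End bregman.

(* Main.v *)
Require Import Defs.
From HB Require Import structures.
From mathcomp Require Import all_boot all_order all_algebra.
From mathcomp Require Import all_classical all_reals all_analysis.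
From mathcomp Require Import ring lra.

Import Order.TTheory GRing.Theory Num.Theory.
Import numFieldNormedType.Exports.

Local Open Scope classical_set_scope.
Local Open Scope ring_scope.

Set Implicit Arguments.
Unset Strict Implicit.
Unset Printing Implicit Defensive.

(** Write h for f + phi / lambda, and let a subgradient of a function at x be
    the slope of an affine function that lies below it on X = dom phi and
    touches it at x.  Expanding the Bregman distance shows that u is a level
    proximal subgradient of f at x exactly when u + grad phi(x) / lambda is a
    subgradient of h at x ([level_prox_subdiffP]).

    The functions conv h and k := hull f + phi / lambda are both convex, both
    lie below h on X, and both lie above every affine function that lies below
    h on X ([faithful_minorant]).  For conv h this is immediate.  For k, which
    is a supremum of affine functions with slopes grad phi(y) / lambda, it
    amounts to every vector being a gradient of phi ([gradient_surjective]):
    by coercivity phi minus a linear form has a minimizer, and essential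
    smoothness keeps this minimizer away from the boundary of the domain.

    For any such convex minorant k, having a single subgradient v of h at x
    means that k is differentiable at x with gradient v and touches h there
    ([unique_subgrad_iff_tangent]).  If k is differentiable and touches h, then
    its gradient is a subgradient of k, hence of h, and every subgradient of h
    is the slope of an affine function below k that touches k at x, so it equals
    the gradient.
    Conversely, if h has a subgradient v at x, then k touches h at x and both
    have the same subgradients at x; when v is the only one, k is
    differentiable ([unique_subgrad_tangent]), because otherwise k would grow
    strictly faster than v in some direction, and a separating hyperplane would
    yield a second subgradient.

    The theorem follows by taking k to be conv h and then hull f + phi / lambda;
    subtracting the differentiable function phi / lambda from the latter turns
    the statement about k into one about the hull. *)

(** * The dot product and the two norms *)

Section DotProduct.
Context {R : realType} {n : nat}.
Implicit Types (u v w z : 'rV[R]_n) (a b : R).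

Lemma dotpC u v : dotp u v = dotp v u.
Proof. by apply: eq_bigr => i _; rewrite mulrC. Qed.

Lemma dotpDr u v w : dotp u (v + w) = dotp u v + dotp u w.
Proof. by rewrite -big_split; apply: eq_bigr => i _; rewrite mxE mulrDr. Qed.

Lemma dotpZr a u v : dotp u (a *: v) = a * dotp u v.
Proof. by rewrite mulr_sumr; apply: eq_bigr => i _; rewrite mxE mulrCA. Qed.

Lemma dotpNr u v : dotp u (- v) = - dotp u v.
Proof. by rewrite -scaleN1r dotpZr mulN1r. Qed.

Lemma dotpBr u v w : dotp u (v - w) = dotp u v - dotp u w.
Proof. by rewrite dotpDr dotpNr. Qed.

Lemma dotp0r u : dotp u 0 = 0.
Proof. by rewrite -(scale0r 0) dotpZr mul0r. Qed.

Lemma dotpDl u v w : dotp (v + w) u = dotp v u + dotp w u.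
Proof. by rewrite dotpC dotpDr !(dotpC u). Qed.

Lemma dotpZl a u v : dotp (a *: v) u = a * dotp v u.
Proof. by rewrite dotpC dotpZr dotpC. Qed.

Lemma dotpNl u v : dotp (- v) u = - dotp v u.
Proof. by rewrite dotpC dotpNr dotpC. Qed.

Lemma dotpBl u v w : dotp (v - w) u = dotp v u - dotp w u.
Proof. by rewrite dotpDl dotpNl. Qed.

Lemma dotp_delta v i : dotp v (delta_mx ord0 i) = v ord0 i.
Proof.
rewrite /dotp (bigD1 i)//= mxE !eqxx mulr1 big1 ?addr0// => j /negPf ji.
by rewrite mxE eqxx ji mulr0.
Qed.

Lemma dotp_ge0 v : 0 <= dotp v v.
Proof. by apply: sumr_ge0 => i _; rewrite -expr2 sqr_ge0. Qed.

Lemma dotp_eq0 v : dotp v v = 0 -> v = 0.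
Proof.
move=> /eqP; rewrite psumr_eq0 => [/allP v0|i _]; last first.
  by rewrite -expr2 sqr_ge0.
apply/rowP => i; rewrite mxE; apply/eqP.
by have := v0 i (mem_index_enum _); rewrite /= mulf_eq0 orbb.
Qed.

Lemma coord_le_norm v i : `|v ord0 i| <= `|v|.
Proof.
rewrite [leRHS]/Num.norm /= mx_normrE.
by apply/bigmax_geP; right; exists (ord0, i).
Qed.

Lemma norm_le_coord v a : 0 <= a -> (forall i, `|v ord0 i| <= a) -> `|v| <= a.
Proof.
move=> a0 va; rewrite [leLHS]/Num.norm /= mx_normrE.
by apply/bigmax_leP; split=> // -[i j] _ /=; rewrite (ord1 i).
Qed.

Lemma dotp_le_norm v z : `|dotp v z| <= (\sum_(i < n) `|v ord0 i|) * `|z|.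
Proof.
rewrite (le_trans (ler_norm_sum _ _ _))// mulr_suml ler_sum// => i _.
by rewrite normrM ler_wpM2l// coord_le_norm.
Qed.

Lemma coord_le_enorm v i : `|v ord0 i| <= enorm v.
Proof.
rewrite -sqrtr_sqr ler_wsqrtr// expr2 /dotp (bigD1 i)//= lerDl.
by apply: sumr_ge0 => j _; rewrite -expr2 sqr_ge0.
Qed.

Lemma enorm_ge0 v : 0 <= enorm v. Proof. exact: sqrtr_ge0. Qed.

Lemma norm_le_enorm v : `|v| <= enorm v.
Proof. by apply: norm_le_coord (enorm_ge0 v) _ => i; exact: coord_le_enorm. Qed.

Lemma enorm_le_coord v a :
  (forall i, `|v ord0 i| <= a) -> enorm v <= Num.sqrt (n%:R * a ^+ 2).
Proof.
move=> va; rewrite ler_wsqrtr// /dotp -[n in n%:R]card_ord mulr_natl.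
rewrite -sumr_const.
apply: ler_sum => i _; rewrite -expr2 -real_normK ?num_real//.
by rewrite lerXn2r ?nnegrE// (le_trans _ (va i)).
Qed.

Lemma dotp_le_enorm v z : dotp v z <= (\sum_(i < n) `|v ord0 i|) * enorm z.
Proof.
rewrite (le_trans (ler_norm _))// (le_trans (dotp_le_norm v z))//.
by rewrite ler_wpM2l ?norm_le_enorm// sumr_ge0.
Qed.

Lemma dotp_continuous v : continuous (dotp v).
Proof.
rewrite /dotp; apply: (@continuous_big R) => [|i _ z].
  exact: add_continuous.
exact: (cvgM (cvg_cst _) (@coord_continuous R 1 n ord0 i z)).
Qed.

End DotProduct.

Lemma convex_setP (R : realType) (M : lmodType R) (A : set M) :
  convex_set A <->
  forall a b (t : R), 0 < t < 1 -> A a -> A b -> A (t *: a + (1 - t) *: b).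
Proof.
rewrite convex_setW; split=> [cA a b t /andP[t0 t1] Aa Ab|cA a b].
  by have := cA a b _ _ (Itv01 (ltW t0) (ltW t1)) t0 t1; rewrite !inE; exact.
by rewrite !inE => Aa Ab t t0 t1; rewrite inE; apply: cA => //; rewrite t0.
Qed.

(** * First-order expansions *)

Section Tangent.
Context {R : realType} {n : nat}.
Implicit Types (f g : 'rV[R]_n -> \bar R) (x v : 'rV[R]_n).

(** An epsilon form of [edifferentiable f x] with gradient [v], which includes
    the finiteness of [f] near [x]; [edifferentiable_tangent] and
    [tangent_edifferentiable] translate in both directions. *)
Definition tangent f x v := forall e : R, 0 < e -> \forall z \near x,
  f z \is a fin_num /\
  `|fine (f z) - fine (f x) - dotp v (z - x)| <= e * `|z - x|.

Lemma tangent_fin f x v : tangent f x v -> f x \is a fin_num.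
Proof. by move=> /(_ _ ltr01)/nbhs_singleton[]. Qed.

Lemma linear_gradient (L : {linear 'rV[R]_n -> R^o}) z :
  L z = dotp (\row_i L (delta_mx ord0 i)) z.
Proof.
rewrite [in LHS](row_sum_delta z) linear_sum; apply: eq_bigr => i _.
by rewrite linearZ/= mxE mulrC.
Qed.

Lemma edifferentiable_tangent f x :
  edifferentiable f x -> tangent f x (gradient f x).
Proof.
move=> [ffin /diff_locallyP[_ /eqaddoP df]] e e0.
have := df e e0; rewrite near_simpl (near_shift x 0) => df0.
apply: filterS2 ffin df0 => z fz; rewrite sub0r !fctE/= addrNK => df0.
split => //; move: df0.
by rewrite (linear_gradient _ (z - x)) opprD addrA.
Qed.

Lemma tangent_edifferentiable f x v :
  tangent f x v -> edifferentiable f x /\ gradient f x = v.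
Proof.
move=> fv; have dlin : linear (dotp v : 'rV[R]_n -> R^o).
  by move=> a y z; rewrite dotpDr dotpZr.
pose sL := GRing.isLinear.Build _ _ _ _ _ dlin.
pose L : {linear 'rV[R]_n -> R^o} := HB.pack (dotp v : 'rV[R]_n -> R^o) sL.
have Lc : continuous L by exact: dotp_continuous.
have fL e : 0 < e -> \forall z \near (0 : 'rV[R]_n),
    `|fine (f (z + x)) - (fine (f x) + L z)| <= e * `|z|.
  move=> e0; have := fv e e0; rewrite (near_shift 0 x).
  by apply: filterS => z /=; rewrite subr0 addrK opprD addrA => -[].
have dL : 'd (fine \o f : 'rV[R]_n -> R^o) x = L :> (_ -> _).
  by apply: diff_unique Lc _; apply/eqaddoP; exact: fL.
split; first split.
- by have := fv 1 ltr01; apply: filterS => z [].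
- by apply/diff_locallyP; rewrite dL; split=> //; apply/eqaddoP; exact: fL.
- by apply/rowP => i; rewrite mxE dL /= dotp_delta.
Qed.

End Tangent.

(** * Separation of convex sets in finite dimension *)

Section Separation.
Context {R : realType} {n : nat}.
Implicit Types (A : set 'rV[R]_n) (x a e w z : 'rV[R]_n).

Lemma closed_norm_ball e (r : R) : closed [set z | `|z - e| <= r].
Proof.
apply: (@preimage_closed _ _ (fun z => `|z - e|) [set s : R | s <= r]).
  by move=> z _; exact: (cvg_norm (cvgB cvg_id (cvg_cst e))).
exact: closed_le.
Qed.

Lemma compact_norm_ball e (r : R) : compact [set z | `|z - e| <= r].
Proof.
apply: bounded_closed_compact.
  exists (r + `|e|); split; first exact: num_real.
  move=> M rM z /= ze; rewrite -(subrK e z) (le_trans (ler_normD _ _))//.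
  by rewrite (le_trans _ (ltW rM))// lerD2r.
exact: closed_norm_ball.
Qed.

(** Near any point [x], a dense convex set contains points in each open orthant
    based at [x].  Two of them whose orthants differ only in coordinate [k] have
    a convex combination with the same [k]-th coordinate as [x], so the
    coordinates of [x] can be matched one after the other. *)
Lemma convex_dense_setT A : convex_set A -> closure A = setT -> A = setT.
Proof.
move=> /convex_setP cA clA; apply/seteqP; split=> // x _.
suff corner (k : nat) (s : 'I_n -> bool) : (k <= n)%N -> exists2 a, A a &
    forall i : 'I_n, if (i < k)%N then a ord0 i = x ord0 i
                     else 0 < (-1) ^+ s i * (a ord0 i - x ord0 i).
  have [a Aa ax] := corner n (fun=> true) (leqnn n).
  suff <- : a = x by [].
  by apply/rowP => i; have := ax i; rewrite ltn_ord.
elim: k s => [|k IH] s kn.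
  (* The unit ball around this corner lies in the open orthant given by s. *)
  pose c : 'rV[R]_n := x + \row_i (-1) ^+ s i.
  have : closure A c by rewrite clA.
  move=> /(_ _ (nbhsx_ballx c 1 ltr01))[a [Aa]]; rewrite -ball_normE /= => ca.
  exists a => // i; have := le_lt_trans (coord_le_norm _ i) ca.
  rewrite !mxE; case: (s i); rewrite ?expr0 ?expr1 ltr_norml => /andP[? ?]; lra.
have kn' : (k < n)%N by [].
pose j := Ordinal kn'.
pose sj b := fun i => if i == j then b else s i.
have [a Aa ax] := IH (sj false) (ltnW kn).
have [b Ab bx] := IH (sj true) (ltnW kn).
have := ax j; rewrite /sj ltnn eqxx expr0 mul1r => aj.
have := bx j; rewrite /sj ltnn eqxx expr1 => bj.
pose t := (x ord0 j - b ord0 j) / (a ord0 j - b ord0 j).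
have ab0 : 0 < a ord0 j - b ord0 j by lra.
have t01 : 0 < t < 1 by rewrite divr_gt0 ?ltr_pdivrMr ?mul1r//=; lra.
exists (t *: a + (1 - t) *: b); first exact: cA.
move=> i; rewrite !mxE ltnS leq_eqVlt.
have [->|ij] := eqVneq i j.
  by rewrite eqxx /= /t; field; rewrite gt_eqF.
have /negPf -> : (i != k :> nat) by apply: contra_neq ij => ?; apply: val_inj.
have := ax i; have := bx i; rewrite /sj (negPf ij) /=.
case: ifP => _ bi ai.
  by rewrite ai bi -mulrDl addrC subrK mul1r.
case/andP: t01 => t0 t1.
have -> : (-1) ^+ s i * (t * a ord0 i + (1 - t) * b ord0 i - x ord0 i) =
  t * ((-1) ^+ s i * (a ord0 i - x ord0 i)) +
  (1 - t) * ((-1) ^+ s i * (b ord0 i - x ord0 i)) by ring.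
by rewrite addr_gt0// mulr_gt0// subr_gt0.
Qed.

Lemma closure_convexl A a z (t : R) : convex_set A -> A a -> closure A z ->
  0 < t < 1 -> closure A (t *: a + (1 - t) *: z).
Proof.
move=> /convex_setP cA Aa clz t01 B Bz.
have gc : (fun y => t *: a + (1 - t) *: y) @ z --> t *: a + (1 - t) *: z.
  exact: (cvgD (cvg_cst _) (@scaler_continuous _ _ (1 - t) z)).
have [y [Ay By]] := clz _ (gc _ Bz).
by exists (t *: a + (1 - t) *: y); split => //; exact: cA.
Qed.

(** The intersection of the closure with a ball through a point of the set is
    compact, so the squared distance attains its minimum there. *)
Lemma nearest_point A e : A !=set0 ->
  exists2 p, closure A p &
    forall z, closure A z -> dotp (p - e) (p - e) <= dotp (z - e) (z - e).
Proof.
move=> [a Aa]; pose d z := dotp (z - e) (z - e).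
pose K := closure A `&` [set z | `|z - e| <= enorm (a - e)].
have Ka : K a by split; [exact: subset_closure|exact: norm_le_enorm].
have dc : continuous d.
  rewrite /d/dotp; apply: (@continuous_big R) => [|i _ z].
    exact: add_continuous.
  have ic : (fun y : 'rV[R]_n => (y - e) ord0 i : R) @ z --> (z - e) ord0 i.
    rewrite mxE; under eq_fun do rewrite mxE.
    exact: (cvgD (@coord_continuous R 1 n ord0 i z) (cvg_cst _)).
  exact: (cvgM ic ic).
have cK : compact K.
  apply: subclosed_compact (@compact_norm_ball e (enorm (a - e))) _.
    apply: closedI; first exact: closed_closure.
    exact: closed_norm_ball.
  by move=> z [].
have [p] := EVT_min_rV (ex_intro _ a Ka) cK (continuous_subspaceT dc).
rewrite inE => -[Ap _] pmin; exists p => // z Az.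
have [ze|ze] := leP `|z - e| (enorm (a - e)).
  by apply: pmin; rewrite inE.
apply: (le_trans (pmin a _)); first by rewrite inE.
have : enorm (a - e) < enorm (z - e) := lt_le_trans ze (norm_le_enorm _).
by rewrite /enorm /d => aez; apply/ltW; rewrite -ltr_sqrt// -sqrtr_gt0
  (le_lt_trans _ aez)// sqrtr_ge0.
Qed.

(** A point [e] outside the closure exists because the set is not dense; the
    hyperplane through its projection [p] orthogonal to [e - p] bounds a half
    space that contains the set. *)
Lemma convex_half_space A : convex_set A -> A !=set0 -> A <> setT ->
  exists w (c : R), w <> 0 /\ forall a, A a -> dotp w a <= c.
Proof.
move=> cA A0 AT.
have [e Ae] : exists e, ~ closure A e.
  by apply: contra_notP AT => /forallNP clA; apply: convex_dense_setT => //;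
     apply/seteqP; split=> // z _; apply: contrapT; exact: clA.
have [p Ap pmin] := nearest_point e A0.
exists (e - p), (dotp (e - p) p); split.
  by move=> /eqP; rewrite subr_eq0 => /eqP ep; apply: Ae; rewrite ep.
move=> a Aa; set q := dotp (a - p) (a - p); set s := dotp (e - p) (a - p).
suff : s <= 0 by rewrite /s dotpBr subr_le0.
rewrite leNgt; apply/negP => s0.
have q0 : 0 <= q by exact: dotp_ge0.
(* For a step t towards a, the squared distance changes by t^2 q - 2 t s,
   which is negative for this t. *)
pose t := Num.min (1 / 2) (s / (q + 1)).
have t0 : 0 < t by rewrite lt_min !divr_gt0//; lra.
have t1 : t <= 1 / 2 by rewrite /t ge_min lexx.
have tq : t * (q + 1) <= s.
  by rewrite -ler_pdivlMr ?ge_min ?lexx ?orbT//; lra.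
have t01 : 0 < t < 1 by lra.
have := pmin _ (closure_convexl cA Aa Ap t01).
have -> : t *: a + (1 - t) *: p - e = t *: (a - p) - (e - p).
  by apply/rowP => i; rewrite !mxE; ring.
have -> : dotp (p - e) (p - e) = dotp (e - p) (e - p).
  by rewrite -(opprB e p) dotpNr dotpNl opprK.
have -> : dotp (t *: (a - p) - (e - p)) (t *: (a - p) - (e - p)) =
    t * (t * q) - 2 * (t * s) + dotp (e - p) (e - p).
  rewrite dotpBr !(dotpBl _ (t *: _)) !dotpZr !dotpZl.
  by rewrite (dotpC (a - p) (e - p)) -/s -/q; ring.
move=> h.
have : t * (t * (q + 1)) <= t * s by rewrite ler_pM2l.
have : 0 < t * s by rewrite mulr_gt0.
nra.
Qed.

End Separation.

(** * Subgradients and gradients of extended-real convex functions *)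

Section ConvexFunctions.
Context {R : realType} {n : nat}.
Implicit Types (D : set 'rV[R]_n) (f g : 'rV[R]_n -> \bar R).
Implicit Types (x y z u v w d : 'rV[R]_n).

(** Finiteness at [x] is part of the notion: where [g] is [-oo], every slope
    would satisfy the inequality. *)
Definition subgrad D g x : set 'rV[R]_n := [set v | g x \is a fin_num /\
  forall z, D z -> (g x + (dotp v (z - x))%:E <= g z)%E].

Lemma lee_fin_ubounds (a : R) (y : \bar R) :
  (forall r, (y <= r%:E)%E -> a <= r) -> (a%:E <= y)%E.
Proof.
case: y => [y|_|ya].
- by rewrite lee_fin; apply; rewrite lexx.
- by rewrite leey.
- by exfalso; have := ya (a - 1) (leNye _); lra.
Qed.

Lemma econvexP D g : econvex D g <->
  forall a b (r s t : R), 0 < t < 1 -> D a -> D b ->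
    (g a <= r%:E)%E -> (g b <= s%:E)%E ->
    D (t *: a + (1 - t) *: b) /\
    (g (t *: a + (1 - t) *: b)%R <= (t * r + (1 - t) * s)%:E)%E.
Proof.
rewrite /econvex convex_setP; split => [cg a b r s t t01 Da Db ga gb|].
  by have := cg (a, r) (b, s) t t01; apply.
by move=> cg [a r] [b s] t t01 [/= Da ga] [/= Db gb]; exact: cg.
Qed.

(** A form of convexity for applications: the endpoints of the segment are
    allowed, the combined point is given up to equality, and any larger real may
    bound the value. *)
Lemma econvex_comb D g a b y (r s q t : R) : econvex D g -> D a -> D b ->
  (g a <= r%:E)%E -> (g b <= s%:E)%E -> 0 <= t <= 1 ->
  y = t *: a + (1 - t) *: b -> t * r + (1 - t) * s <= q ->
  D y /\ (g y <= q%:E)%E.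
Proof.
move=> /econvexP cg Da Db ga gb /andP[t0 t1] ->.
have [->|tn0] := eqVneq t 0.
  rewrite subr0 scale0r scale1r add0r mul0r mul1r add0r => sq.
  by split=> //; rewrite (le_trans gb)// lee_fin.
have [->|tn1] := eqVneq t 1.
  rewrite subrr scale0r scale1r addr0 mul0r mul1r addr0 => rq.
  by split=> //; rewrite (le_trans ga)// lee_fin.
have t01 : 0 < t < 1 by rewrite !lt_neqAle tn1 eq_sym tn0 t0.
move=> tq; have [Dy gy] := cg _ _ _ _ _ t01 Da Db ga gb; split=> //.
by rewrite (le_trans gy)// lee_fin.
Qed.

Lemma near_ray x d (P : set 'rV[R]_n) : (\forall y \near x, P y) ->
  exists2 t : R, 0 < t & forall s, 0 <= s <= t -> P (x + s *: d).
Proof.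
move=> /nbhs_ballP[e /= e0 eP]; pose t := e / (2 * (`|d| + 1)).
have d0 : 0 < `|d| + 1 by rewrite ltr_wpDl.
exists t => [|s /andP[s0 st]]; first by rewrite divr_gt0// mulr_gt0.
apply: eP; rewrite -ball_normE /= opprD addNKr normrN normrZ ger0_norm//.
apply: (@le_lt_trans _ _ (s * (`|d| + 1))); first by rewrite ler_wpM2l// lerDl.
have : t * (`|d| + 1) = e / 2 by rewrite /t; field; rewrite gt_eqF.
have : s * (`|d| + 1) <= t * (`|d| + 1) by rewrite ler_pM2r.
lra.
Qed.

(** If a value [r] above [g z] were below the tangent, convexity would force [g]
    below the tangent by a fixed slope along the segment from [x] to [z]. *)
Lemma tangent_subgrad D g x v :
  econvex D g -> D x -> tangent g x v -> subgrad D g x v.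
Proof.
move=> cg Dx gv; have gx := tangent_fin gv; split=> // z Dz.
rewrite -(fineK gx) -EFinD; apply: lee_fin_ubounds => r gzr.
rewrite leNgt; apply/negP => rlt.
set N := `|z - x|; have N0 : 0 <= N by exact: normr_ge0.
pose del := fine (g x) + dotp v (z - x) - r.
have del0 : 0 < del by rewrite subr_gt0.
pose e := del / (N + 1).
have e0 : 0 < e by rewrite divr_gt0//; lra.
have [t t0 tP] := near_ray (z - x) (gv e e0).
pose s := Num.min t 1.
have s01 : 0 < s <= 1 by rewrite lt_min t0 ltr01 ge_min lexx orbT.
have /andP[s0 s1] := s01.
have [|gyfin] := tP s; first by rewrite (ltW s0) ge_min lexx.
have gxr : (g x <= (fine (g x))%:E)%E by rewrite fineK.
have [|//|_ gy] := econvex_comb cg Dz Dx gzr gxr (t := s)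
  (y := x + s *: (z - x)) _ _ (lexx _).
- by rewrite (ltW s0).
- by apply/rowP => i; rewrite !mxE; ring.
move: gy; rewrite -(fineK gyfin) lee_fin addrC addrK.
rewrite dotpZr normrZ (ger0_norm (ltW s0)) -/N => gy.
rewrite ler_norml /= => /andP[gy' _].
have eN : e * (N + 1) = del by rewrite /e divfK// gt_eqF// ltr_wpDl.
have : s * del <= s * (e * N) by rewrite /del; clear - gy gy'; lra.
rewrite ler_pM2l//; clear - eN e0; lra.
Qed.

(** Testing the two slopes in the direction [u - v] bounds the squared length of
    [u - v] by any positive number. *)
Lemma tangent_local_minorant g x v u : tangent g x v ->
  (\forall z \near x, (g x + (dotp u (z - x))%:E <= g z)%E) -> u = v.
Proof.
move=> gv gu; pose w := u - v.
suff : dotp w w = 0 by move=> /dotp_eq0/eqP; rewrite subr_eq0 => /eqP.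
apply/eqP; rewrite eq_le dotp_ge0 andbT.
apply/ler_addgt0Pr => e e0; rewrite add0r.
set N := `|w|; have N0 : 0 <= N by exact: normr_ge0.
have eN0 : 0 < e / (N + 1) by rewrite divr_gt0//; lra.
have [t t0 tP] := near_ray w (filterI gu (gv _ eN0)).
have [|gut [gyfin]] := tP t; first by rewrite lexx ltW.
move: gut; have -> : x + t *: w - x = t *: w by rewrite addrAC subrr add0r.
rewrite -(fineK gyfin) -(fineK (tangent_fin gv)).
rewrite -EFinD lee_fin ler_norml !dotpZr normrZ (gtr0_norm t0) -/N /=.
move=> h /andP[_ h'].
have eN : e / (N + 1) * (N + 1) = e by rewrite divfK// gt_eqF// ltr_wpDl.
have : t * dotp w w <= t * (e / (N + 1) * N).
  rewrite [dotp w w](_ : _ = dotp u w - dotp v w); last by rewrite -dotpBl.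
  by clear - h h'; lra.
by rewrite ler_pM2l//; clear - eN eN0; lra.
Qed.

Lemma tangent_addZ f g k x u v (c : R) : tangent f x u -> tangent g x v ->
  (\forall z \near x, k z = (f z + c%:E * g z)%E) ->
  tangent k x (u + c *: v).
Proof.
move=> fu gv kfg e e0; pose e' := e / (2 * (`|c| + 1)).
have c0 : 0 <= `|c| by exact: normr_ge0.
have e'0 : 0 < e' by rewrite divr_gt0// mulr_gt0//; lra.
have e20 : 0 < e / 2 by rewrite divr_gt0.
have fx := tangent_fin fu; have gx := tangent_fin gv.
have kx := nbhs_singleton kfg.
near=> z.
have kz : k z = (f z + c%:E * g z)%E by near: z.
have [fz hf] : f z \is a fin_num /\
  `|fine (f z) - fine (f x) - dotp u (z - x)| <= e / 2 * `|z - x|.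
  by near: z; exact: fu.
have [gz hg] : g z \is a fin_num /\
  `|fine (g z) - fine (g x) - dotp v (z - x)| <= e' * `|z - x|.
  by near: z; exact: gv.
rewrite kz kx -(fineK fx) -(fineK gx) -(fineK fz) -(fineK gz).
rewrite -!EFinM -!EFinD/=; split=> //.
rewrite dotpDl dotpZl.
set N := `|z - x|; rewrite -/N in hf hg.
set F := fine (f z) - fine (f x) - dotp u (z - x) in hf.
set G := fine (g z) - fine (g x) - dotp v (z - x) in hg.
have -> : fine (f z) + c * fine (g z) - (fine (f x) + c * fine (g x)) -
  (dotp u (z - x) + c * dotp v (z - x)) = F + c * G by rewrite /F /G; ring.
rewrite (le_trans (ler_normD _ _))// normrM.
have N0 : 0 <= N by exact: normr_ge0.
have e'c : e' * (`|c| + 1) = e / 2 by rewrite /e'; field; lra.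
have : `|c| * `|G| <= `|c| * (e' * N) by rewrite ler_wpM2l.
have : 0 <= e' * N by rewrite mulr_ge0// ltW.
have : (e' * (`|c| + 1)) * N = (e / 2) * N by rewrite e'c.
nra.
Unshelve. all: by end_near. Qed.

End ConvexFunctions.

(** * A unique subgradient is a gradient *)

Section UniqueSubgradient.
Context {R : realType} {n : nat}.
Implicit Types (D : set 'rV[R]_n) (g : 'rV[R]_n -> \bar R).
Implicit Types (x y z v w d : 'rV[R]_n).

(** For convex [g] the difference quotients along a ray increase, so these are
    the directions [d] in which the one-sided derivative of [g] at [x] is less
    than [dotp v d + e], or at most that with equality attained. *)
Definition slow_dirs D g x v (e : R) : set 'rV[R]_n :=
  [set d | exists2 t : R, 0 < t &
     D (x + t *: d) /\
     (g (x + t *: d)%R <= (fine (g x) + t * (dotp v d + e))%:E)%E].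

(** The step lengths [t] and [r] of two slow directions may differ; the step
    for their combination is the weighted harmonic mean
    [1 / (s / t + (1 - s) / r)]. *)
Lemma slow_dirs_convex D g x v e :
  econvex D g -> convex_set (slow_dirs D g x v e).
Proof.
move=> cg; apply/convex_setP => a b s /andP[s0 s1].
move=> [t t0 [Da ga]] [r r0 [Db gb]].
have s1' : 0 < 1 - s by lra.
(* Combining the endpoints of the two steps with weights m and k, divided by
   m + k, yields the step of length 1 / (m + k). *)
pose m := s / t; pose k := (1 - s) / r.
have m0 : 0 < m by rewrite divr_gt0.
have k0 : 0 < k by rewrite divr_gt0.
have mk0 : 0 < m + k by lra.
have mt : m * t = s by rewrite /m divfK// gt_eqF.
have kr : k * r = 1 - s by rewrite /k divfK// gt_eqF.
exists (m + k)^-1; first by rewrite invr_gt0.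
pose p := m / (m + k).
have p01 : 0 <= p <= 1.
  by rewrite /p divr_ge0 ?(ltW m0) ?(ltW mk0)//= ler_pdivrMr// mul1r lerDl ltW.
have q1 : 1 - p = k / (m + k) by rewrite /p; field; rewrite gt_eqF.
apply: (econvex_comb cg Da Db ga gb p01).
  apply/rowP => i; rewrite q1 /p !mxE -kr -mt; field; rewrite gt_eqF//.
have e1 : e = (m * t + k * r) * e by rewrite mt kr addrC subrK mul1r.
rewrite q1 /p dotpDr !dotpZr -kr -mt [X in _ <= _ + _ * (_ + X)]e1.
by rewrite le_eqVlt; apply/orP; left; apply/eqP; field; rewrite gt_eqF.
Qed.

(** If the convex set of slow directions were not the whole space, it would lie
    in a half space [dotp w d <= c].  A point [z] whose excess of [g] over the
    affine minorant is less than [rho] gives the slow direction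
    [(z - x) / (rho / e)], so that [dotp w (z - x)] is at most [c * rho / e].
    A small positive multiple of [w] can then be added to [v]. *)
Lemma unique_subgrad_slow D g x v e : econvex D g -> D x ->
  subgrad D g x v -> (forall u, subgrad D g x u -> u = v) -> 0 < e ->
  slow_dirs D g x v e = setT.
Proof.
move=> cg Dx [gx gv] uniq e0; apply: contrapT => AT.
have A0 : slow_dirs D g x v e 0.
  exists 1 => //; rewrite scaler0 addr0 dotp0r; split=> //.
  by rewrite -[X in (X <= _)%E](fineK gx) lee_fin; clear - e0; lra.
have [w [c [w0 wc]]] :=
  convex_half_space (slow_dirs_convex cg) (ex_intro _ _ A0) AT.
have c0 : 0 <= c by have := wc _ A0; rewrite dotp0r.
(* With c + 1 in place of c, the multiple of w also makes sense for c = 0. *)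
apply: w0; pose k := e / (c + 1).
have c1 : 0 < c + 1 by rewrite ltr_wpDl.
have k0 : 0 < k by rewrite divr_gt0.
suff /uniq/eqP : subgrad D g x (v + k *: w).
  by rewrite -subr_eq0 addrAC subrr add0r scaler_eq0 gt_eqF//= => /eqP.
split=> // z Dz; rewrite -(fineK gx) -EFinD; apply: lee_fin_ubounds => r gzr.
set d := z - x; rewrite dotpDl dotpZl.
have rv : fine (g x) + dotp v d <= r.
  by rewrite -lee_fin EFinD fineK// (le_trans (gv z Dz)).
apply/ler_addgt0Pr => eta eta0.
(* The margin eta makes the excess rho positive even where the minorant
   touches g, since a slow direction requires a positive step. *)
pose rho := r - fine (g x) - dotp v d + eta.
have rho0 : 0 < rho by rewrite /rho; clear - rv eta0; lra.
have s0 : 0 < rho / e by rewrite divr_gt0.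
have se : rho / e * e = rho by rewrite divfK// gt_eqF.
have : dotp w ((rho / e)^-1 *: d) <= c.
  apply: wc; exists (rho / e) => //.
  rewrite scalerA divff ?gt_eqF// scale1r addrC subrK; split=> //.
  rewrite (le_trans gzr)// lee_fin mulrDr dotpZr mulrA divff ?gt_eqF// mul1r se.
  by rewrite /rho; clear - eta0; lra.
rewrite dotpZr ler_pdivrMl// => wd.
suff : k * dotp w d <= rho by rewrite /rho; clear; lra.
apply: (@le_trans _ _ (k * (rho / e * c))); first by rewrite ler_pM2l.
have -> : k * (rho / e * c) = rho * (c / (c + 1)).
  by rewrite /k; field; rewrite !gt_eqF.
rewrite ler_piMr ?(ltW rho0)// ler_pdivrMr// mul1r; clear; lra.
Qed.

Lemma slow_dirs_ray D g x v e d : econvex D g -> D x -> g x \is a fin_num ->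
  slow_dirs D g x v e d -> exists2 t : R, 0 < t &
    forall s, 0 <= s <= t -> D (x + s *: d) /\
      (g (x + s *: d)%R <= (fine (g x) + s * (dotp v d + e))%:E)%E.
Proof.
move=> cg Dx gx [t t0 [Dt gt]]; exists t => // s /andP[s0 st].
have gxr : (g x <= (fine (g x))%:E)%E by rewrite fineK.
have st01 : 0 <= s / t <= 1.
  by rewrite divr_ge0 ?(ltW t0)//= ler_pdivrMr// mul1r.
apply: (econvex_comb cg Dt Dx gt gxr st01).
  by apply/rowP => i; rewrite !mxE; field; rewrite gt_eqF.
by rewrite le_eqVlt; apply/orP; left; apply/eqP; field; rewrite gt_eqF.
Qed.

(** The subgradient inequality bounds [g] from below.  From above, each of the
    finitely many rays along the coordinate axes obeys the bound with error [e],
    and convexity propagates it to a neighbourhood: a vector supported on the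
    first [k + 1] coordinates is the midpoint of twice its part on the first [k]
    coordinates and twice its last component, each bounded with error
    [e / 2]. *)
Lemma unique_subgrad_tangent D g x v : econvex D g -> D x ->
  subgrad D g x v -> (forall u, subgrad D g x u -> u = v) -> tangent g x v.
Proof.
move=> cg Dx gxv uniq; have [gx gv] := gxv.
have gxr : (g x <= (fine (g x))%:E)%E by rewrite fineK.
suff upper (k : nat) : (k <= n)%N -> forall e : R, 0 < e ->
    exists2 t : R, 0 < t &
    forall d, (forall i : 'I_n, (k <= i)%N -> d ord0 i = 0) ->
    `|d| <= t -> D (x + d) /\
      (g (x + d)%R <= (fine (g x) + dotp v d + e * `|d|)%:E)%E.
  move=> e e0; have [t t0 tP] := upper n (leqnn n) e e0.
  have : \forall z \near x, `|z - x| <= t.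
    apply/nbhs_ballP; exists t => // z; rewrite -ball_normE /= distrC.
    exact: ltW.
  apply: filterS => z zt.
  have [i|//|] := tP (z - x); first by rewrite leqNgt ltn_ord.
  rewrite addrC subrK => Dz gz.
  have := gv z Dz; rewrite -(fineK gx) -EFinD => zg.
  have gzfin : g z \is a fin_num.
    rewrite fin_numElt (le_lt_trans gz) ?ltry// andbT.
    by rewrite (lt_le_trans _ zg)// ltNyr.
  split=> //; move: gz zg; rewrite -(fineK gzfin) !lee_fin /= => gz zg.
  have eN : 0 <= e * `|z - x| by rewrite mulr_ge0// ltW.
  by rewrite ler_norml; apply/andP; split; clear - gz zg eN; lra.
elim: k => [|k IH] kn e e0.
  exists 1 => // d d0 _; have -> : d = 0 by apply/rowP => i; rewrite mxE d0.
  by rewrite addr0 dotp0r normr0 mulr0 !addr0.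
pose j := Ordinal kn; pose ej : 'rV[R]_n := delta_mx ord0 j.
have e20 : 0 < e / 2 by rewrite divr_gt0.
have [t1 t10 t1P] := IH (ltnW kn) _ e20.
have all_slow d : slow_dirs D g x v (e / 2) d.
  by rewrite (unique_subgrad_slow cg Dx gxv uniq e20).
have [t2 t20 t2P] := slow_dirs_ray cg Dx gx (all_slow ej).
have [t3 t30 t3P] := slow_dirs_ray cg Dx gx (all_slow (- ej)).
pose t := Num.min (t1 / 2) (Num.min (t2 / 2) (t3 / 2)).
exists t; first by rewrite !lt_min !divr_gt0.
move=> d d0; rewrite !le_min => /and3P[dt1 dt2 dt3].
pose s := d ord0 j; pose d' := d - s *: ej.
have ds : `|s| <= `|d| by exact: coord_le_norm.
have d'i (i : 'I_n) : d' ord0 i = if i == j then 0 else d ord0 i.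
  rewrite !mxE eqxx /=; case: eqVneq => [->|_] /=; first by rewrite mulr1 subrr.
  by rewrite mulr0 subr0.
have d'd : `|d'| <= `|d|.
  apply: norm_le_coord => // i; rewrite d'i; case: ifP; rewrite ?normr0//.
  by rewrite coord_le_norm.
have [i ki||Dd' gd'] := t1P (2 *: d').
- rewrite mxE d'i; case: eqVneq => [|ij]; rewrite ?mulr0// d0 ?mulr0//.
  by rewrite ltn_neqAle ki andbT eq_sym.
- by rewrite normrZ normr_nat; clear - d'd dt1; lra.
have [Ds gs] : D (x + (2 * s) *: ej) /\
    (g (x + (2 * s) *: ej)%R <=
     (fine (g x) + 2 * s * dotp v ej + `|s| * e)%:E)%E.
  have [s0|s0] := leP 0 s.
    have [|Ds gs] := t2P (2 * s).
      by rewrite mulr_ge0//=; move: ds; rewrite ger0_norm//; clear - dt2; lra.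
    split=> //; rewrite (le_trans gs)// lee_fin ger0_norm//; clear; lra.
  have [|Ds gs] := t3P (2 * - s).
    move: ds; rewrite ltr0_norm// => ds.
    by apply/andP; split; clear - dt3 ds s0; lra.
  move: Ds gs; rewrite scalerN -scaleNr mulrN opprK dotpNr => Ds gs.
  split=> //; rewrite (le_trans gs)// lee_fin ltr0_norm//; clear; lra.
have half : 0 <= (1 / 2 : R) <= 1 by clear; lra.
apply: (econvex_comb cg Dd' Ds gd' gs half).
  by apply/rowP => i; rewrite !mxE; field.
have -> : dotp v d = dotp v d' + s * dotp v ej.
  by rewrite -dotpZr -dotpDr /d' subrK.
rewrite dotpZr normrZ normr_nat.
have : e * `|d'| <= e * `|d| by rewrite ler_pM2l.
have : e * `|s| <= e * `|d| by rewrite ler_pM2l.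
clear; lra.
Qed.

End UniqueSubgradient.

(** * Lower semicontinuous functions attain their minimum *)

Section LowerSemicontinuousMinimum.

(** The sets [K `&` [set y | F y <= F z]] are nested and nonempty; by lower
    semicontinuity, a cluster point of the filter they generate belongs to all
    of them. *)
Lemma lsc_compact_min (T : topologicalType) (R : realType) (F : T -> \bar R)
    (K : set T) :
  compact K -> K !=set0 -> lower_semicontinuous F ->
  (forall z, K z -> F z != -oo%E) ->
  exists2 p, K p & forall z, K z -> (F p <= F z)%E.
Proof.
move=> cK K0 lscF FNy.
pose S z := K `&` [set y | (F y <= F z)%E].
have SF : ProperFilter (filter_from K S).
  apply: filter_from_proper; last by move=> z Kz; exists z; split=> //=.
  apply: filter_from_filter => // y z Ky Kz.
  have [yz|/ltW zy] := leP (F y) (F z).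
    by exists y => // w [Kw wy]; split; split=> //=; exact: le_trans yz.
  by exists z => // w [Kw wz]; split; split=> //=; exact: le_trans zy.
have [|p [Kp clp]] := cK (filter_from K S) SF.
  by case: K0 => z Kz; exists z => // y [].
exists p => // z Kz; rewrite leNgt; apply/negP => zp.
have Fz : F z \is a fin_num.
  by rewrite fin_numE FNy//= lt_eqF// (lt_le_trans zp)// leey.
have [V Vp VF] : exists2 V, nbhs p V &
    forall y, V y -> ((fine (F z))%:E < F y)%E.
  by apply: lscF; rewrite fineK.
have [y [[_ yz] Vy]] := clp (S z) V (ex_intro2 _ _ z Kz (fun _ => id)) Vp.
by have := VF y Vy; rewrite fineK// ltNge yz.
Qed.

Lemma lsc_subr (T : topologicalType) (R : realType) (F : T -> \bar R)
    (l : T -> R) : lower_semicontinuous F -> continuous l ->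
  lower_semicontinuous (fun y => (F y - (l y)%:E)%E).
Proof.
move=> lscF lc x a; rewrite lteBrDr// -EFinD => ax.
have [b ab bx] : exists2 b : R, a + l x < b & (b%:E < F x)%E.
  case: (F x) ax => [r| |]; rewrite ?lte_fin => ax.
  - by exists ((a + l x + r) / 2); rewrite ?lte_fin; lra.
  - by exists (a + l x + 1); rewrite ?ltry//; lra.
  - by [].
have [V Vx VF] := lscF x b bx.
have lV : \forall y \near x, l y < b - a.
  by apply: (cvgr_lt (l x) (lc x)); lra.
exists (V `&` [set y | l y < b - a]); first exact: filterI.
move=> y [Vy /= ly]; rewrite EFinN lteBrDr// -EFinD.
by rewrite (le_lt_trans _ (VF y Vy))// lee_fin; clear - ly; lra.
Qed.

End LowerSemicontinuousMinimum.

(** * The gradient of a coercive essentially smooth function is onto *)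

Section GradientSurjective.
Context {R : realType} {n : nat}.
Implicit Types (phi : 'rV[R]_n -> \bar R) (x y z u v w d a p : 'rV[R]_n).

Lemma edom_convex phi : econvex setT phi -> convex_set (edom phi).
Proof.
move=> /econvexP cphi; apply/convex_setP => a b t t01 Xa Xb.
have ub z : edom phi z -> exists r, (phi z <= r%:E)%E.
  rewrite /edom /=; case: (phi z) => [r| |] // _; first by exists r.
  by exists 0; rewrite leNye.
have [r ar] := ub a Xa; have [s bs] := ub b Xb.
have [//|//|_ h] := cphi a b r s t t01 _ _ ar bs.
by rewrite /edom /= (le_lt_trans h)// ltry.
Qed.

Lemma interior_segment (D : set 'rV[R]_n) a y (t : R) : convex_set D ->
  D y -> D° a -> 0 < t <= 1 -> D° (y + t *: (a - y)).
Proof.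
move=> /convex_setP cD Dy Da /andP[t0].
rewrite le_eqVlt => /orP[/eqP ->|t1].
  by rewrite scale1r addrC subrK.
have /nbhs_ballP[e /= e0 eD] := Da.
apply/nbhs_ballP; exists (t * e) => /=; first by rewrite mulr_gt0.
move=> z; rewrite -ball_normE /= => ze.
pose b := y + t^-1 *: (z - y).
have -> : z = t *: b + (1 - t) *: y.
  by apply/rowP => i; rewrite !mxE; field; rewrite gt_eqF.
apply: cD => //; first by rewrite t0.
apply: eD; rewrite -ball_normE /=.
have -> : a - b = t^-1 *: (y + t *: (a - y) - z).
  by apply/rowP => i; rewrite !mxE; field; rewrite gt_eqF.
by rewrite normrZ gtr0_norm ?invr_gt0// ltr_pdivrMl.
Qed.

(** Outside a large ball, [phi z] exceeds [(\sum_i `|v_i| + 1) * enorm z], and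
    hence [phi z - dotp v z] exceeds [enorm z]; the minimum over the ball is
    thus a global one. *)
Lemma one_coercive_tilted_min phi v : dgf phi -> one_coercive phi ->
  exists2 p, edom phi p & forall z, (phi p + (dotp v (z - p))%:E <= phi z)%E.
Proof.
move=> [[[a _ a_fin] proper] lsc_phi _ _ _] coer.
have phiNy z : phi z != -oo%E by exact: proper.
have pa : phi a \is a fin_num by rewrite fin_numE phiNy a_fin.
pose c := \sum_(i < n) `|v ord0 i| + 1.
pose F z := (phi z - (dotp v z)%:E)%E.
have [M Mc] : exists M : R, forall z, M < enorm z ->
    (c%:E < phi z * (enorm z)^-1%:E)%E.
  apply: contrapT => noM; move: coer; rewrite /one_coercive limf_einfE => supoo.
  suff : (ereal_sup [set ereal_inf ((fun x => phi x * (enorm x)^-1%:E) @` V)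
      | V in enorm_infty] <= c%:E)%E by rewrite supoo leye_eq.
  apply: ge_ereal_sup => _ [V [M VM] <-]; rewrite leNgt; apply/negP => cV.
  apply: noM; exists M => z /VM Vz; apply: (lt_le_trans cV).
  by apply: ereal_inf_lbound; exists z.
pose alpha := fine (F a).
have Fa : F a = alpha%:E by rewrite /alpha /F -(fineK pa) -EFinB.
pose r := Num.max (Num.max M 0) (Num.max alpha `|a|).
have far z : r < `|z| -> (alpha%:E < F z)%E.
  move=> /lt_le_trans/(_ (norm_le_enorm z)).
  rewrite !gt_max => /andP[/andP[Mz z0] /andP[az _]].
  have := Mc z Mz; rewrite lte_pdivlMr// -EFinM => cz.
  rewrite /F lteBrDr// -EFinD (le_lt_trans _ cz)// lee_fin.
  have := dotp_le_enorm v z; rewrite /c mulrDl mul1r; lra.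
have Ka : [set z | `|z - 0| <= r] a.
  by rewrite /= subr0 !le_max lexx !orbT.
have lscF := lsc_subr lsc_phi (@dotp_continuous _ _ v).
have FNy z : [set z | `|z - 0| <= r] z -> F z != -oo%E.
  by move=> _; rewrite /F; case: (phi z) (phiNy z).
have [p Kp pmin] := lsc_compact_min (@compact_norm_ball _ _ 0 r)
  (ex_intro _ a Ka) lscF FNy.
have Fp z : (F p <= F z)%E.
  have [zr|/far zr] := leP `|z| r; first by apply: pmin; rewrite /= subr0.
  by apply: (le_trans (pmin _ Ka)); rewrite -/(F a) Fa ltW.
have pp : phi p \is a fin_num.
  rewrite fin_numE phiNy/=; apply: contraTN (Fp a) => /eqP pp.
  by rewrite Fa /F pp.
exists p => [|z]; first by rewrite /edom /= ltey_eq pp.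
have := Fp z; rewrite /F leeBrDr// -(fineK pp) -EFinB -!EFinD.
by rewrite dotpBr addrAC addrA.
Qed.

(** Suppose that [p] is a boundary point and approach it by [u k] along the
    segment from an interior point [a].  The three inequalities comparing
    [u k] with [p] and with [a + d] bound [dotp (gradient phi (u k)) d] by a
    constant independent of [k].  Taking for [d] small multiples of the
    coordinate vectors bounds the gradients, whereas essential smoothness makes
    them blow up. *)
Lemma subgradient_interior phi v p : dgf phi -> essentially_smooth phi ->
  edom phi p -> (forall z, (phi p + (dotp v (z - p))%:E <= phi z)%E) ->
  (edom phi)° p.
Proof.
move=> [[_ proper] _ cphi [a Ya] diff] [_ _ smooth] Xp pmin.
apply: contrapT => Yp.
have fin z : edom phi z -> phi z \is a fin_num.
  by move=> Xz; rewrite fin_numE proper//= lt_eqF.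
pose u k := p + harmonic k *: (a - p).
have t01 k : 0 < (harmonic k : R) <= 1.
  by rewrite /harmonic invr_gt0 ltr0Sn/= invf_le1 ?ltr0Sn// ler1n.
have Yu k : (edom phi)° (u k).
  by apply: interior_segment => //; exact: edom_convex.
have up : u @ \oo --> p.
  have := cvgD (cvg_cst p) (cvgZ (@cvg_harmonic R) (cvg_cst (a - p))).
  by rewrite scale0r addr0; exact.
have bdry : (closure (edom phi) `\` (edom phi)°) p.
  by split=> //; exact: subset_closure.
have lim A : \forall k \near \oo, A <= enorm (gradient phi (u k)).
  exact: (cvgryPge _).1 (smooth u p Yu up bdry) A.
have bound d k : edom phi (a + d) -> dotp (gradient phi (u k)) d <=
    fine (phi (a + d)) - fine (phi p) - dotp v (a - p).
  move=> Xad; have /andP[t0 t1] := t01 k.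
  have Xu := interior_subset (Yu k).
  have [_ sub] :=
    tangent_subgrad cphi I (edifferentiable_tangent (diff _ (Yu k))).
  have h1 := sub (a + d) I; have h2 := sub p I; have h3 := pmin (u k).
  move: h1 h2 h3; rewrite -(fineK (fin _ Xu)) -(fineK (fin _ Xad)).
  rewrite -(fineK (fin _ Xp)) -!EFinD !lee_fin /=.
  set G := gradient phi (u k); set t := harmonic k in t0 t1 *.
  have uE : u k = p + t *: (a - p) by [].
  have -> : a + d - u k = (1 - t) *: (a - p) + d.
    by rewrite uE; apply/rowP => i; rewrite !mxE; ring.
  have -> : p - u k = - t *: (a - p).
    by rewrite uE; apply/rowP => i; rewrite !mxE; ring.
  have -> : u k - p = t *: (a - p) by rewrite uE addrAC subrr add0r.
  rewrite (dotpDr G _ d) !dotpZr => h1 h2 h3.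
  (* Slopes along the segment from p to a increase, and start at least at
     that of the affine minorant. *)
  have : t * dotp v (a - p) <= t * dotp G (a - p) by clear - h2 h3; lra.
  rewrite ler_pM2l// => h4.
  have : (1 - t) * dotp v (a - p) <= (1 - t) * dotp G (a - p).
    by rewrite ler_wpM2l// subr_ge0.
  by clear - h1 h3; lra.
have /nbhs_ballP[e /= e0 eX] := Ya.
have eX' i (s : R) : `|s| = e / 2 -> edom phi (a + s *: delta_mx ord0 i).
  move=> se; apply: eX; rewrite -ball_normE /= opprD addNKr normrN normrZ se.
  apply: (@le_lt_trans _ _ (e / 2 * 1)); last lra.
  rewrite ler_wpM2l//; first by clear - e0; lra.
  apply: norm_le_coord => // j.
  by rewrite mxE eqxx /=; case: (j == i); rewrite ?normr1 ?normr0.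
pose C i (s : R) := fine (phi (a + s *: delta_mx ord0 i)) - fine (phi p)
  - dotp v (a - p).
pose B := \sum_(i < n) (`|C i (e / 2)| + `|C i (- (e / 2))|) / (e / 2).
have e20 : 0 < e / 2 by rewrite divr_gt0.
have gB k i : `|gradient phi (u k) ord0 i| <= B.
  apply: (@le_trans _ _ ((`|C i (e / 2)| + `|C i (- (e / 2))|) / (e / 2))).
    rewrite ler_pdivlMr// -[e / 2 in leLHS]gtr0_norm// -normrM.
    have := bound _ k (eX' i (e / 2) (gtr0_norm e20)).
    have := bound _ k (eX' i (- (e / 2)) _).
    rewrite normrN => /(_ (gtr0_norm e20)).
    rewrite -!/(C _ _) !dotpZr dotp_delta.
    have := ler_norm (C i (e / 2)); have := ler_norm (C i (- (e / 2))).
    have := normr_ge0 (C i (e / 2)); have := normr_ge0 (C i (- (e / 2))).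
    by move=> h1 h2 h3 h4 h5 h6; rewrite ler_norml; apply/andP; split;
      clear -h1 h2 h3 h4 h5 h6; lra.
  rewrite /B (bigD1 i)//= lerDl; apply: sumr_ge0 => j _.
  by rewrite divr_ge0 ?addr_ge0// ltW.
have [N _ /(_ N (leqnn N))] := lim (Num.sqrt (n%:R * B ^+ 2) + 1).
have := enorm_le_coord (gB N).
move=> /= h1 h2; suff : false by []. 
have := le_trans h2 h1; clear; lra.
Qed.

Lemma gradient_surjective phi v :
  dgf phi -> one_coercive phi -> essentially_smooth phi ->
  exists2 y, (edom phi)° y & gradient phi y = v.
Proof.
move=> dphi coer smooth.
have [p Xp pmin] := one_coercive_tilted_min v dphi coer.
have Yp := subgradient_interior dphi smooth Xp pmin.
exists p => //; apply/esym.
have [_ _ _ _ /(_ _ Yp)/edifferentiable_tangent pg] := dphi.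
apply: tangent_local_minorant pg _; apply: filterE => z; exact: pmin.
Qed.

End GradientSurjective.

(** * Minorants with the same affine minorants *)

Section ConvexMinorants.
Context {R : realType} {n : nat}.
Implicit Types (D : set 'rV[R]_n) (f g h k : 'rV[R]_n -> \bar R).
Implicit Types (x y z u v w : 'rV[R]_n).

(** The property shared by all functions between the supremum of the affine
    minorants of [h] and [h] itself. *)
Definition faithful_minorant D h k :=
  (forall z, D z -> (k z <= h z)%E) /\
  (forall v c, (forall z, D z -> ((dotp v z + c)%:E <= h z)%E) ->
     forall z, D z -> ((dotp v z + c)%:E <= k z)%E).

Lemma econvex_affine D w (c : \bar R) : convex_set D ->
  econvex D (fun x => ((dotp w x)%:E + c)%E).
Proof.
move=> /convex_setP cD; apply/econvexP => a b r s t t01 Da Db.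
have /andP[t0 t1] := t01.
case: c => [c| |] //=; last by move=> _ _; split; [exact: cD|rewrite leNye].
rewrite -!EFinD !lee_fin => ar bs; split; first exact: cD.
rewrite dotpDr !dotpZr.
have : t * (dotp w a + c) <= t * r by rewrite ler_pM2l.
have : (1 - t) * (dotp w b + c) <= (1 - t) * s by rewrite ler_pM2l// subr_gt0.
by clear; lra.
Qed.

Lemma econvex_ereal_sup D (I : Type) (P : set I)
    (g : I -> 'rV[R]_n -> \bar R) : convex_set D ->
  (forall i, P i -> econvex D (g i)) ->
  econvex D (fun x => ereal_sup [set g i x | i in P]).
Proof.
move=> /convex_setP cD cg; apply/econvexP => a b r s t t01 Da Db ar bs.
split; first exact: cD.
apply: ge_ereal_sup => _ [i Pi <-].
have /econvexP cgi := cg i Pi.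
have le_sup z : (g i z <= ereal_sup [set g i z | i in P])%E.
  by apply: ereal_sup_ubound; exists i.
by have [] := cgi _ _ _ _ _ t01 Da Db (le_trans (le_sup a) ar)
  (le_trans (le_sup b) bs).
Qed.

Lemma eq_econvex D g k : (forall z, D z -> g z = k z) ->
  econvex D g -> econvex D k.
Proof.
move=> gk /econvexP cg; apply/econvexP => a b r s t t01 Da Db.
rewrite -(gk a)// -(gk b)// => ar bs.
have [Dab gab] := cg _ _ _ _ _ t01 Da Db ar bs.
by split=> //; rewrite -gk.
Qed.

Lemma econv_convex D h : convex_set D -> econvex D (econv D h).
Proof. by move=> cD; apply: econvex_ereal_sup => // g []. Qed.

Lemma econv_faithful D h : convex_set D -> faithful_minorant D h (econv D h).
Proof.
move=> cD; split=> [z Dz|v c vh z Dz].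
  by apply: ge_ereal_sup => _ [g [_ gh] <-]; exact: gh.
apply: ereal_sup_ubound; exists (fun y => ((dotp v y)%:E + c%:E)%E) => //.
by split=> //; exact: econvex_affine.
Qed.

(** A subgradient of [h] is the slope of an affine minorant of [h], which [k]
    must dominate; as it touches [h] at [x], so does [k]. *)
Lemma faithful_minorant_subgrad D h k x v : faithful_minorant D h k -> D x ->
  subgrad D h x v -> k x = h x /\ subgrad D k x v.
Proof.
move=> [kh hk] Dx [hx hv].
have below z : D z -> (h x + (dotp v (z - x))%:E <= k z)%E.
  move=> Dz; rewrite -(fineK hx) -EFinD dotpBr addrCA.
  apply: hk => // y Dy; have := hv y Dy.
  by rewrite -(fineK hx) -EFinD dotpBr addrCA.
have kx : k x = h x.
  apply/eqP; rewrite eq_le kh//=.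
  by have := below x Dx; rewrite subrr dotp0r adde0.
by split=> //; split; rewrite kx.
Qed.

Lemma subgrad_minorant D h k x v : (forall z, D z -> (k z <= h z)%E) ->
  k x = h x -> subgrad D k x v -> subgrad D h x v.
Proof.
move=> kh kx [kfin kv]; split; rewrite -kx// => z Dz.
exact: le_trans (kv z Dz) (kh z Dz).
Qed.

Lemma unique_subgrad_iff_tangent D h k x v : econvex D k ->
  faithful_minorant D h k -> D° x ->
  subgrad D h x = [set v] <-> tangent k x v /\ k x = h x.
Proof.
move=> ck fk Dx; have Dx' := interior_subset Dx; split=> [hv|[kv kx]].
  have hxv : subgrad D h x v by rewrite hv.
  have [kx kxv] := faithful_minorant_subgrad fk Dx' hxv; split=> //.
  apply: unique_subgrad_tangent kxv _ => // u ku.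
  have : subgrad D h x u by apply: subgrad_minorant ku => //; case: fk.
  by rewrite hv.
apply/seteqP; split=> [u|_ ->].
  move=> /(faithful_minorant_subgrad fk Dx')[_ [_ ku]].
  by apply: tangent_local_minorant kv _; exact: filterS Dx.
apply: (@subgrad_minorant _ _ k) => //; first by case: fk.
exact: tangent_subgrad.
Qed.

End ConvexMinorants.

(** * The Bregman hull as a convex minorant *)

Section Bregman.
Context {R : realType} {n : nat}.
Implicit Types (phi f g : 'rV[R]_n -> \bar R) (lambda : R).
Implicit Types (x y z u v w : 'rV[R]_n).

Definition tilted phi lambda f y : \bar R := (f y + lambda^-1%:E * phi y)%E.

Lemma dgf_fin phi x : dgf phi -> edom phi x -> phi x \is a fin_num.
Proof.
by move=> [[_ proper] _ _ _ _] Xx; rewrite fin_numE proper//= lt_eqF.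
Qed.

Lemma dgf_dom_convex phi : dgf phi -> convex_set (edom phi).
Proof. by move=> [_ _ cphi _ _]; exact: edom_convex. Qed.

Lemma bregmanE phi x y : dgf phi -> edom phi x -> (edom phi)° y ->
  bregman phi x y =
  (fine (phi x) - fine (phi y) - dotp (gradient phi y) (x - y))%:E.
Proof.
move=> dphi Xx Yy; rewrite /bregman mem_set//.
rewrite -(fineK (dgf_fin dphi Xx)).
by rewrite -(fineK (dgf_fin dphi (interior_subset Yy))).
Qed.

(** The gradient of [phi / lambda] at [x] absorbs the linear term of the Bregman
    distance.  Properness of [f] excludes [f x = +oo], for which the left-hand
    side would force [f] to be [+oo] on all of [edom phi]. *)
Lemma level_prox_subdiffP phi lambda f x u :
  dgf phi -> eproper (edom phi) f -> (edom phi)° x ->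
  level_prox_subdiff phi lambda f x u <->
  subgrad (edom phi) (tilted phi lambda f) x (u + lambda^-1 *: gradient phi x).
Proof.
move=> dphi fproper Yx; have Xx := interior_subset Yx.
have [[z0 Xz0 fz0] fNy] := fproper.
have hE z : edom phi z -> tilted phi lambda f z =
    (f z + (lambda^-1 * fine (phi z))%:E)%E.
  by move=> Xz; rewrite /tilted -[in LHS](fineK (dgf_fin dphi Xz)).
split=> [[_ ux]|[hx ux]].
  have fx : f x \is a fin_num.
    rewrite fin_numE fNy//=; apply/negP => /eqP fx.
    have := ux z0 Xz0; rewrite fx bregmanE// -EFinM -EFinN leye_eq.
    exact/negP.
  split=> [|z Xz]; first by rewrite hE// -(fineK fx).
  have := ux z Xz; rewrite bregmanE// !hE// -(fineK fx) -!EFinM -!EFinB -!EFinD.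
  case: (f z) (fNy z Xz) => [r| |] // _; rewrite ?leey// !lee_fin.
  by rewrite dotpDl dotpZl /=; clear; lra.
have fx : f x \is a fin_num.
  move: hx; rewrite hE//; case: (f x) => //.
split=> // z Xz; have := ux z Xz.
rewrite bregmanE// !hE// -(fineK fx) -!EFinM -!EFinB -!EFinD.
case: (f z) (fNy z Xz) => [r| |] // _; rewrite ?leey// !lee_fin.
by rewrite dotpDl dotpZl /=; clear; lra.
Qed.

Lemma ereal_sup_addr (I : Type) (P : set I) (F : I -> \bar R) (c : R) :
  (ereal_sup [set F i | i in P] + c%:E =
   ereal_sup [set F i + c%:E | i in P])%E.
Proof.
apply/eqP; rewrite eq_le; apply/andP; split.
  rewrite -leeBrDr//; apply: ge_ereal_sup => _ [i Pi <-].
  by rewrite leeBrDr//; apply: ereal_sup_ubound; exists i.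
apply: ge_ereal_sup => _ [i Pi <-]; rewrite leeD2r//.
by apply: ereal_sup_ubound; exists i.
Qed.

(** Minus the conjugate of [tilted phi lambda f] at the slope
    [lambda^-1 *: gradient phi y]. *)
Definition hull_height phi lambda f y : \bar R := (left_env phi lambda f y +
  (lambda^-1 * (fine (phi y) - dotp (gradient phi y) y))%:E)%E.

Lemma tilted_hullE phi lambda f x : dgf phi -> edom phi x ->
  tilted phi lambda (hull phi lambda f) x =
  ereal_sup [set (dotp (lambda^-1 *: gradient phi y) x)%:E +
    hull_height phi lambda f y | y in (edom phi)°]%E.
Proof.
move=> dphi Xx; rewrite /tilted /hull /right_env.
rewrite -(fineK (dgf_fin dphi Xx)) -EFinM.
rewrite -ereal_supN image_comp ereal_sup_addr; congr ereal_sup.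
apply: eq_imagel => y Yy /=; rewrite bregmanE// /hull_height dotpZl.
case: (left_env _ _ _ _) => [e| |] //=.
rewrite -!EFinD; congr EFin.
by rewrite dotpBr; ring.
Qed.

Lemma tilted_hull_convex phi lambda f : dgf phi ->
  econvex (edom phi) (tilted phi lambda (hull phi lambda f)).
Proof.
move=> dphi; apply: (@eq_econvex _ _ _ (fun x => ereal_sup
  [set (dotp (lambda^-1 *: gradient phi y) x)%:E +
    hull_height phi lambda f y | y in (edom phi)°]%E)).
  by move=> z Xz; rewrite tilted_hullE.
apply: econvex_ereal_sup; first exact: dgf_dom_convex.
by move=> y _; apply: econvex_affine; exact: dgf_dom_convex.
Qed.

(** An affine minorant of slope [v] is recovered from the term of the supremum
    whose [y] satisfies [gradient phi y = lambda *: v]. *)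
Lemma tilted_hull_faithful phi lambda f : dgf phi -> one_coercive phi ->
  essentially_smooth phi -> eproper (edom phi) f -> 0 < lambda ->
  faithful_minorant (edom phi) (tilted phi lambda f)
    (tilted phi lambda (hull phi lambda f)).
Proof.
move=> dphi coer smooth [_ fNy] lambda0; split=> [z Xz|v c vh z Xz].
  rewrite tilted_hullE//; apply: ge_ereal_sup => _ [y Yy <-].
  have : (left_env phi lambda f y <=
      f z + lambda^-1%:E * bregman phi z y)%E.
    by apply: ereal_inf_lbound; exists z.
  rewrite bregmanE// /hull_height /tilted -(fineK (dgf_fin dphi Xz)) dotpZl.
  case: (f z) (fNy z Xz) => [r| |] // _; last by move=> _; rewrite addye// leey.
  case: (left_env _ _ _ _) => [e| |] //=; last by rewrite addNye addeNy !leNye.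
  by rewrite -!EFinM -!EFinD !lee_fin dotpBr; clear; lra.
have [y Yy Gy] := gradient_surjective (lambda *: v) dphi coer smooth.
rewrite tilted_hullE//; apply: le_ereal_sup_tmp.
eexists; first by exists y.
rewrite Gy scalerA mulVf ?gt_eqF// scale1r EFinD leeD2lE//.
rewrite /hull_height Gy -leeBlDr// -EFinB; apply: le_ereal_inf_tmp.
move=> _ [w Xw <-]; have := vh w Xw.
rewrite bregmanE// Gy /tilted -(fineK (dgf_fin dphi Xw)) -!EFinM.
case: (f w) (fNy w Xw) => [r| |] // _; last by rewrite addye// !leey.
rewrite -!EFinD !lee_fin !dotpZl dotpBr /=.
set s := fine (phi w); set t := fine (phi y).
have -> : lambda^-1 * (t - lambda * dotp v y) = lambda^-1 * t - dotp v y.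
  by field; rewrite gt_eqF.
have -> : lambda^-1 * (s - t - lambda * (dotp v w - dotp v y)) =
  lambda^-1 * s - lambda^-1 * t - dotp v w + dotp v y.
  by field; rewrite gt_eqF.
by clear; lra.
Qed.

Lemma tilted_tangent phi lambda f x u : dgf phi -> (edom phi)° x ->
  tangent f x u <->
  tangent (tilted phi lambda f) x (u + lambda^-1 *: gradient phi x).
Proof.
move=> dphi Yx; have [_ _ _ _ /(_ _ Yx)/edifferentiable_tangent phix] := dphi.
split=> [hu|].
  by apply: (tangent_addZ hu phix); exact: filterE.
move=> tu; rewrite -(addrK (lambda^-1 *: gradient phi x) u) -scaleNr.
apply: (tangent_addZ tu phix).
apply: filterS Yx => z Xz; rewrite /tilted -(fineK (dgf_fin dphi Xz)) -!EFinM.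
by rewrite mulNr EFinN addeK.
Qed.

Lemma tilted_eq phi lambda f g x : dgf phi -> edom phi x ->
  tilted phi lambda g x = tilted phi lambda f x <-> g x = f x.
Proof.
move=> dphi Xx; rewrite /tilted -(fineK (dgf_fin dphi Xx)) -EFinM.
by split=> [/(congr1 (fun e => e - (lambda^-1 * fine (phi x))%:E)%E)|->//];
  rewrite !addeK.
Qed.

End Bregman.

Theorem theorem3p11 (R : realType) (n : nat)
    (phi f : 'rV[R]_n -> \bar R) (lambda : R) (x : 'rV[R]_n)
    (X := edom phi)
    (h := fun y => (f y + lambda^-1%:E * phi y)%E) :
  dgf phi -> one_coercive phi -> legendre phi ->
  eproper X f -> elsc X f -> prox_bounded phi f ->
  0 < lambda -> (lambda%:E < prox_threshold phi f)%E -> X° x ->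
  [/\ (exists u, level_prox_subdiff phi lambda f x = [set u]) <->
        (edifferentiable (econv X h) x /\ econv X h x = h x),
      (edifferentiable (econv X h) x /\ econv X h x = h x) <->
        (edifferentiable (hull phi lambda f) x /\ hull phi lambda f x = f x) &
      forall u, level_prox_subdiff phi lambda f x = [set u] ->
        gradient (econv X h) x = u + lambda^-1 *: gradient phi x /\
        gradient (hull phi lambda f) x = u].
Proof.
move=> dphi coer [smooth _] fproper _ _ lambda0 _ Xx.
pose p := lambda^-1 *: gradient phi x.
have levelE u : level_prox_subdiff phi lambda f x = [set u] <->
    subgrad X h x = [set u + p].
  split=> E; apply/seteqP; split=> w.
  - move=> hw; have : level_prox_subdiff phi lambda f x (w - p).
      by apply/level_prox_subdiffP => //; rewrite subrK.
    by rewrite E /= => <-; rewrite subrK.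
  - by move=> ->; apply/level_prox_subdiffP => //; rewrite E.
  - by move=> /level_prox_subdiffP; rewrite E => /(_ dphi fproper Xx)/addIr.
  - by move=> ->; apply/level_prox_subdiffP => //; rewrite E.
have convE v : subgrad X h x = [set v] <->
    tangent (econv X h) x v /\ econv X h x = h x.
  have cX := dgf_dom_convex dphi.
  apply: unique_subgrad_iff_tangent Xx; first exact: econv_convex.
  exact: econv_faithful.
have hullE u : subgrad X h x = [set u + p] <->
    tangent (hull phi lambda f) x u /\ hull phi lambda f x = f x.
  have tE := @tilted_tangent _ _ phi lambda (hull phi lambda f) x u dphi Xx.
  have eE := @tilted_eq _ _ phi lambda f (hull phi lambda f) x dphi
    (interior_subset Xx).
  have kE := @unique_subgrad_iff_tangent _ _ X h
    (tilted phi lambda (hull phi lambda f)) x (u + p)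
    (@tilted_hull_convex _ _ phi lambda f dphi)
    (tilted_hull_faithful dphi coer smooth fproper lambda0) Xx.
  by rewrite kE; split=> -[/tE ? /eE].
have bP : (exists u, subgrad X h x = [set u + p]) <->
    edifferentiable (econv X h) x /\ econv X h x = h x.
  split=> [[u /convE[/tangent_edifferentiable[]]]//|[dG Gx]].
  exists (gradient (econv X h) x - p); rewrite subrK; apply/convE.
  by split=> //; exact: edifferentiable_tangent.
have cP : (exists u, subgrad X h x = [set u + p]) <->
    edifferentiable (hull phi lambda f) x /\ hull phi lambda f x = f x.
  split=> [[u /hullE[/tangent_edifferentiable[]]]//|[dG Gx]].
  exists (gradient (hull phi lambda f) x); apply/hullE.
  by split=> //; exact: edifferentiable_tangent.
split.
- by rewrite -bP; split=> -[u /levelE]; exists u => //; exact/levelE.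
- by rewrite -bP -cP.
- move=> u /levelE hu; split.
  + by have /convE[/tangent_edifferentiable[]] := hu.
  + by have /hullE[/tangent_edifferentiable[]] := hu.
Qed.
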